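(* If $\mathsf{Ext}:\{0,1\}^n\to\{0,1\}^m$ is a $(k,\epsilon)$-extractor for $(n,k)$-bit-fixing sources, then for every $l\in\mathbb{N}$, the function $\mathsf{Ext}':\{0,1\}^{ln}\to\{0,1\}^m$ given by $\mathsf{Ext}'(x_1,\dots,x_l)=\bigoplus_{i\in[l]}\mathsf{Ext}(x_i)$ (with each $x_i\in\{0,1\}^n$) is a $(2lk,\epsilon^{\Theta(l)})$-extractor for $(ln,2lk)$-bit-fixing sources.
   Context: An $(N,K)$-bit-fixing source is a distribution on $\{0,1\}^N$ in which some unknown set of $K$ coordinates are independent uniform bits and the other coordinates are fixed constants. A function $E:\{0,1\}^N\to\{0,1\}^m$ is a $(K,\epsilon)$-extractor for $(N,K)$-bit-fixing sources if for every such source $X$, $E(X)$ is $\epsilon$-close in statistical distance to uniform on $\{0,1\}^m$. $\oplus$ denotes bitwise XOR.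
   Formalization: The formal version assumes ε ≤ ε0 < 1/2 (for 1/2 ≤ ε < 1 a constant Ext with m = 1 is a counterexample), and the constants hidden in Θ(l) depend on ε0 and on a bound C with n ≤ C(k+1), since absolute constants are impossible. *)

(* Defs.v *)
From HB Require Import structures.
From mathcomp Require Import all_boot all_order all_algebra.
From mathcomp Require Import all_classical all_reals all_analysis.

Set Implicit Arguments.
Unset Strict Implicit.
Unset Printing Implicit Defensive.

Import Order.TTheory GRing.Theory Num.Theory.

Local Open Scope ring_scope.

Notation bits N := {ffun 'I_N -> bool}.

(* A distribution on a finite type is given by its probability mass function. *)
Section FiniteDistributions.
Variable R : realType.

Definition uniform (T : finType) : T -> R := fun _ => #|T|%:R^-1.

Definition pushforward (T U : finType) (f : T -> U) (p : T -> R) : U -> R :=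
  fun y => \sum_(x | f x == y) p x.

Definition stat_dist (T : finType) (p q : T -> R) : R :=
  2^-1 * \sum_x `|p x - q x|.

(* The coordinates are independent: coordinate i is a uniform bit if i is in S
   and is the constant a i otherwise. *)
Definition bit_fixing_dist (N : nat) (S : {set 'I_N}) (a : bits N) :
    bits N -> R :=
  fun x => \prod_(i < N) (if i \in S then 2^-1 else (x i == a i)%:R).

Definition is_bit_fixing_source (N K : nat) (X : bits N -> R) : Prop :=
  exists (S : {set 'I_N}) (a : bits N),
    #|S| = K /\ X =1 bit_fixing_dist S a.

Definition is_bit_fixing_extractor (N K m : nat) (eps : R)
    (E : bits N -> bits m) : Prop :=
  forall X : bits N -> R, is_bit_fixing_source K X ->
    stat_dist (pushforward E X) (@uniform (bits m)) <= eps.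

Definition is_Theta_id (f : nat -> R) : Prop :=
  exists c1 c2 : R, [/\ 0 < c1, 0 < c2 &
    forall l : nat, c1 * l%:R <= f l <= c2 * l%:R].

End FiniteDistributions.

Lemma block_index_subproof (l n : nat) (i : 'I_l) (j : 'I_n) :
  (i * n + j < l * n)%N.
Proof.
apply: (@leq_trans (i.+1 * n)%N); first by rewrite mulSn addnC ltn_add2r.
by rewrite leq_mul2r ltn_ord orbT.
Qed.

(* {0,1}^(ln) is read as l consecutive blocks of n bits. *)
Definition block_index (l n : nat) (i : 'I_l) (j : 'I_n) : 'I_(l * n) :=
  Ordinal (block_index_subproof i j).

Definition block (l n : nat) (x : bits (l * n)) (i : 'I_l) : bits n :=
  [ffun j => x (block_index i j)].

Definition xor_ext (l n m : nat) (Ext : bits n -> bits m) :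
    bits (l * n) -> bits m :=
  fun x => [ffun j => \big[addb/false]_(i < l) Ext (block x i) j].

(* Main.v *)
(* Bitwise XOR of independent variables is convolution on (Z/2)^m, and in L1 norm
   the deviation from uniform is submultiplicative under convolution, while
   convolving with any distribution does not increase it. A block with at least
   k free bits is a mixture of k-bit sources, hence eps-close to uniform, and a
   count of the free bits shows that a constant fraction of the l blocks are of
   this kind. With g such blocks the distance is at most (2 eps)^g, and
   2 eps <= eps^c with c > 0 because eps stays away from 1/2. *)
Require Import Defs.
From HB Require Import structures.
From mathcomp Require Import all_boot all_order all_algebra.
From mathcomp Require Import all_classical all_reals all_analysis.
From mathcomp Require Import ring lra zify.

Set Implicit Arguments.
Unset Strict Implicit.
Unset Printing Implicit Defensive.

Import Order.TTheory GRing.Theory Num.Theory.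

Local Open Scope ring_scope.

(* [all_analysis] shadows [pushforward] by the image measure. *)
Local Notation push := Defs.pushforward.

(** * XOR and convolution on the group $(\mathbb{Z}/2)^m$ *)

Definition bxor (m : nat) (v w : bits m) : bits m := [ffun j => v j (+) w j].

Lemma bxorK (m : nat) (v : bits m) : involutive (bxor v).
Proof. by move=> w; apply/ffunP => j; rewrite !ffunE addbA addbb. Qed.

Lemma bxorC (m : nat) (v w : bits m) : bxor v w = bxor w v.
Proof. by apply/ffunP => j; rewrite !ffunE addbC. Qed.

Section Convolution.
Variables (R : realType) (m : nat).
Implicit Types p q : bits m -> R.

(** Every element of $(\mathbb{Z}/2)^m$ is its own inverse, so [bxor v y] is the difference of [y]
    and [v]. *)
Definition conv p q : bits m -> R := fun y => \sum_v p v * q (bxor v y).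

Lemma sum_bxor p (v : bits m) : \sum_y p (bxor v y) = \sum_y p y.
Proof. by rewrite [RHS](reindex_inj (inv_inj (bxorK v))). Qed.

(** Young's inequality: the triangle inequality, then translation invariance of the sum over [y]. *)
Lemma conv_norm1 p q :
  \sum_y `|conv p q y| <= (\sum_y `|p y|) * \sum_y `|q y|.
Proof.
have: \sum_y `|conv p q y| <= \sum_y \sum_v `|p v| * `|q (bxor v y)|.
  apply: ler_sum => y _; apply: le_trans (ler_norm_sum _ _ _) _.
  by apply: ler_sum => v _; rewrite normrM.
move=> /le_trans; apply; rewrite exchange_big /= mulr_suml.
by apply: ler_sum => v _; rewrite -mulr_sumr (sum_bxor (fun y => `|q y|)).
Qed.

Local Notation U := (@uniform R (bits m)).

Lemma sum_uniform : \sum_y U y = 1.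
Proof.
rewrite sumr_const -[_ *+ _]mulr_natr mulVf // pnatr_eq0.
by rewrite card_ffun card_bool expn_eq0.
Qed.

(** The uniform distribution is constant, so convolving it with a function of mass 1 gives it
    back. *)
Lemma conv_sub_uniform p q : \sum_y p y = 1 ->
  forall y, conv p q y - U y = conv p (fun z => q z - U z) y.
Proof.
move=> p1 y; rewrite /conv -[in LHS](mul1r (U y)) -p1 mulr_suml -sumrB.
by apply: eq_bigr => v _; rewrite mulrBr.
Qed.

(** Replacing [p] by [p - U] costs a constant times the total mass of [q - U], which is 0. *)
Lemma conv_sub_uniform2 p q : \sum_y p y = 1 -> \sum_y q y = 1 ->
  forall y, conv p q y - U y = conv (fun z => p z - U z) (fun z => q z - U z) y.
Proof.
move=> p1 q1 y; rewrite conv_sub_uniform //.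
apply/eqP; rewrite -subr_eq0 -sumrB; apply/eqP.
under eq_bigr do rewrite -mulrBl opprB addrC subrK.
rewrite -mulr_sumr.
suff -> : \sum_v (q (bxor v y) - U (bxor v y)) = 0 by rewrite mulr0.
under eq_bigr do rewrite bxorC.
by rewrite (sum_bxor (fun z => q z - U z)) sumrB q1 sum_uniform subrr.
Qed.

End Convolution.

(** * XOR of independent samples *)

Section Independent.
Variables (R : realType) (T : finType) (m : nat) (E : T -> bits m).

Definition xor_family l (z : 'I_l -> T) : bits m :=
  [ffun j => \big[addb/false]_(i < l) E (z i) j].

Definition xor_dist l (X : 'I_l -> T -> R) (y : bits m) : R :=
  \sum_(z : {ffun 'I_l -> T} | xor_family z == y) \prod_(i < l) X i (z i).

Definition ffun_cons l (tz : T * {ffun 'I_l -> T}) : {ffun 'I_l.+1 -> T} :=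
  [ffun i => if unlift ord0 i is Some j then tz.2 j else tz.1].

Lemma ffun_cons_bij l : bijective (@ffun_cons l).
Proof.
exists (fun z : {ffun 'I_l.+1 -> T} => (z ord0, [ffun j => z (lift ord0 j)])).
- move=> [t z]; congr pair; first by rewrite ffunE unlift_none.
  by apply/ffunP => j; rewrite !ffunE liftK.
- move=> z; apply/ffunP => i; rewrite !ffunE.
  by case: unliftP => [j ->|->] //=; rewrite ffunE.
Qed.

(** Condition on the first sample [t]: the others must XOR to [bxor (E t) y]. Grouping the [t] by
    the value of [E t] gives the convolution. *)
Lemma xor_dist_recl l (X : 'I_l.+1 -> T -> R) y :
  xor_dist X y =
  conv (push E (X ord0)) (xor_dist (fun i => X (lift ord0 i))) y.
Proof.
have lhsE : xor_dist X y =
    \sum_(t : T) X ord0 t * xor_dist (fun i => X (lift ord0 i)) (bxor (E t) y).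
  rewrite /xor_dist (reindex (@ffun_cons l)); last exact/onW_bij/ffun_cons_bij.
  under [RHS]eq_bigr do rewrite mulr_sumr.
  rewrite pair_big_dep /=; apply: eq_big => [[t z]|[t z] _] /=; last first.
    rewrite big_ord_recl !ffunE unlift_none; congr (_ * _).
    by apply: eq_bigr => i _; rewrite ffunE liftK.
  rewrite -(inj_eq (inv_inj (bxorK (E t)))); congr (_ == _).
  apply/ffunP => j; rewrite !ffunE big_ord_recl !ffunE unlift_none addbA addbb /=.
  by apply: eq_bigr => i _; rewrite !ffunE liftK.
rewrite lhsE /conv /Defs.pushforward (partition_big E xpredT) //=.
by apply: eq_bigr => v _; rewrite mulr_suml; apply: eq_bigr => t /eqP ->.
Qed.

Lemma sum_pushforward (p : T -> R) : \sum_y push E p y = \sum_t p t.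
Proof. by rewrite [RHS](partition_big E xpredT). Qed.

Lemma sum_xor_dist l (X : 'I_l -> T -> R) : (forall i, \sum_t X i t = 1) ->
  \sum_y xor_dist X y = 1.
Proof.
move=> X1; transitivity (\sum_(z : {ffun 'I_l -> T}) \prod_i X i (z i)).
  rewrite [RHS](partition_big
    (fun z : {ffun 'I_l -> T} => xor_family z) xpredT) //.
by rewrite -bigA_distr_bigA big1.
Qed.

(** Induction on [l], one convolution per sample. The factors [e i] bound L1 distances, which are
    twice statistical distances; [e i = 1] serves for samples without a useful bound. *)
Lemma xor_dist_uniform l (X : 'I_l -> T -> R) (e : 'I_l -> R) :
  (forall i t, 0 <= X i t) -> (forall i, \sum_t X i t = 1) ->
  (forall i, 0 <= e i) ->
  (forall i, e i = 1 \/
    \sum_y `|push E (X i) y - @uniform R _ y| <= e i) ->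
  stat_dist (xor_dist X) (@uniform R (bits m)) <= \prod_i e i.
Proof.
move=> X0 X1 e0 eP; rewrite /stat_dist ler_pdivrMl ?ltr0n//.
elim: l X e X0 X1 e0 eP => [|l IH] X e X0 X1 e0 eP.
  (* With no samples the bound is 2, the trivial L1 distance of two probability distributions. *)
  rewrite big_ord0 mulr1.
  have xd0 y : 0 <= xor_dist X y by apply: sumr_ge0 => z _; apply: prodr_ge0.
  have u0 y : 0 <= @uniform R (bits m) y by rewrite invr_ge0.
  apply: (@le_trans _ _ (\sum_y (xor_dist X y + @uniform R (bits m) y))).
    apply: ler_sum => y _; apply: le_trans (ler_normB _ _) _.
    by rewrite !ger0_norm.
  by rewrite big_split /= sum_xor_dist // sum_uniform.
rewrite big_ord_recl mulrCA.
set Y := fun i => X (lift ord0 i).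
have {}IH : \sum_y `|xor_dist Y y - @uniform R _ y| <= 2 * \prod_i e (lift ord0 i).
  by apply: IH => // i; rewrite /Y ?X1 //; exact: eP.
have p1 : \sum_y push E (X ord0) y = 1 by rewrite sum_pushforward.
have q1 : \sum_y xor_dist Y y = 1 by apply: sum_xor_dist => i; exact: X1.
case: (eP ord0) => [->|le_e].
  (* Here the first factor only contributes its L1 norm, which is 1. *)
  under eq_bigr do rewrite xor_dist_recl conv_sub_uniform //.
  apply: le_trans (conv_norm1 _ _) _; rewrite mul1r.
  suff -> : \sum_y `|push E (X ord0) y| = 1 by rewrite mul1r.
  by rewrite -[RHS]p1; apply: eq_bigr => y _; rewrite ger0_norm // sumr_ge0.
under eq_bigr do rewrite xor_dist_recl conv_sub_uniform2 //.
apply: le_trans (conv_norm1 _ _) _.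
by apply: ler_pM => //; apply: sumr_ge0.
Qed.

End Independent.

(** * Bit-fixing sources with more free bits *)

Section BitFixing.
Variable R : realType.

Lemma bit_fixing_dist_ge0 N (S : {set 'I_N}) a x :
  0 <= bit_fixing_dist R S a x.
Proof. by apply: prodr_ge0 => i _; case: ifP => // _; rewrite invr_ge0. Qed.

Lemma sum_bit_fixing_dist N (S : {set 'I_N}) a :
  \sum_x bit_fixing_dist R S a x = 1.
Proof.
rewrite /bit_fixing_dist -(bigA_distr_bigA
  (fun i b => if i \in S then 2^-1 else (b == a i)%:R : R)) big1 // => i _.
rewrite big_bool; case: ifP => _; first by rewrite [RHS]splitr mul1r.
by case: (a i); rewrite /= ?addr0 ?add0r.
Qed.

(** Condition on the value of the free bit [j]. *)
Lemma bit_fixing_dist_split N (S : {set 'I_N}) a j x : j \in S ->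
  bit_fixing_dist R S a x =
  2^-1 * bit_fixing_dist R (S :\ j) [ffun i => if i == j then true else a i] x +
  2^-1 * bit_fixing_dist R (S :\ j) [ffun i => if i == j then false else a i] x.
Proof.
move=> jS; rewrite /bit_fixing_dist (bigD1 j) //= jS.
have fixj b : \prod_(i < N) (if i \in S :\ j then 2^-1 else
    (x i == [ffun i => if i == j then b else a i] i)%:R : R) =
    (x j == b)%:R *
    \prod_(i < N | i != j) (if i \in S then 2^-1 else (x i == a i)%:R).
  rewrite (bigD1 j) //= !inE eqxx ffunE eqxx /=; congr (_ * _).
  by apply: eq_bigr => i ij; rewrite !inE ij /= ffunE (negbTE ij).
by rewrite !fixj; case: (x j); rewrite /= ?mul1r ?mul0r ?mulr0 ?addr0 ?add0r.
Qed.

(** Fixing one free bit either way writes the source as an even mixture of two sources with [K] free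
    bits, and statistical distance is convex. *)
Lemma extractorS N K m (eps : R) (E : bits N -> bits m) :
  is_bit_fixing_extractor K eps E -> is_bit_fixing_extractor K.+1 eps E.
Proof.
move=> extE X [S] [a] [cS XE].
have [j jS] : exists j, j \in S by apply/card_gt0P; rewrite cS.
have cSj : #|S :\ j| = K by move: cS; rewrite (cardsD1 j) jS => -[].
pose Y b := bit_fixing_dist R (S :\ j) [ffun i => if i == j then b else a i].
have YP b : stat_dist (push E (Y b)) (@uniform R _) <= eps.
  by apply: extE; exists (S :\ j), [ffun i => if i == j then b else a i].
have pE y : push E X y =
    2^-1 * push E (Y true) y + 2^-1 * push E (Y false) y.
  rewrite /Defs.pushforward !mulr_sumr -big_split; apply: eq_bigr => x _ /=.
  by rewrite XE (bit_fixing_dist_split a x jS).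
apply: (@le_trans _ _
  (2^-1 * stat_dist (push E (Y true)) (@uniform R _) +
   2^-1 * stat_dist (push E (Y false)) (@uniform R _))); last first.
  by have := YP true; have := YP false; lra.
rewrite /stat_dist -mulrDr ler_pM2l ?invr_gt0 // !mulr_sumr -big_split.
apply: ler_sum => y _ /=; rewrite pE.
set p := push _ _ _; set q := push _ _ _; set u := @uniform _ _ _.
have -> : 2^-1 * p + 2^-1 * q - u = 2^-1 * (p - u) + 2^-1 * (q - u) by field.
by apply: le_trans (ler_normD _ _) _; rewrite !normrM normfV normr_nat.
Qed.

(** Needed because a block may contain more than [k] free bits. *)
Lemma extractor_leq N K K' m (eps : R) (E : bits N -> bits m) : (K <= K')%N ->
  is_bit_fixing_extractor K eps E -> is_bit_fixing_extractor K' eps E.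
Proof.
move=> /subnKC <- extE; elim: (K' - K)%N => [|d IH]; first by rewrite addn0.
by rewrite addnS; exact: extractorS.
Qed.

End BitFixing.

(** * Splitting a source into blocks *)

Section Blocks.
Variables l n : nat.

Lemma block_index_bij :
  bijective (fun p : 'I_l * 'I_n => block_index p.1 p.2).
Proof.
apply: inj_card_bij; last by rewrite card_prod !card_ord.
move=> [i j] [i' j'] /(congr1 val) /= e.
have n0 : (0 < n)%N by apply: leq_ltn_trans (ltn_ord j).
congr pair; apply: val_inj => /=.
  by move/(congr1 (divn^~ n)): e; rewrite !divnMDl // !divn_small // !addn0.
by move/(congr1 (modn^~ n)): e; rewrite !modnMDl !modn_small.
Qed.

Lemma blocks_bij : bijective (fun x : bits (l * n) => [ffun i => block x i]).
Proof.
apply: inj_card_bij; last first.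
  by rewrite !card_ffun !card_ord card_bool mulnC expnM.
move=> x x' /ffunP e; apply/ffunP => k; have [g _ gK] := block_index_bij.
by have /ffunP /(_ (g k).2) := e (g k).1; rewrite !ffunE gK.
Qed.

Definition block_set (S : {set 'I_(l * n)}) (i : 'I_l) : {set 'I_n} :=
  [set j | block_index i j \in S].

Lemma sum_card_block_set S : (\sum_(i < l) #|block_set S i| = #|S|)%N.
Proof.
rewrite -[RHS]sum1_card (reindex _ (onW_bij _ block_index_bij)) /=.
under eq_bigr do rewrite -sum1_card.
by rewrite pair_big_dep /=; apply: eq_bigl => -[i j] /=; rewrite inE.
Qed.

(** Grouping the product by blocks shows that the blocks are independent bit-fixing sources. *)
Lemma bit_fixing_dist_blocks (R : realType) S (a x : bits (l * n)) :
  bit_fixing_dist R S a x =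
  \prod_(i < l) bit_fixing_dist R (block_set S i) (block a i) (block x i).
Proof.
rewrite /bit_fixing_dist (reindex _ (onW_bij _ block_index_bij)) /=.
rewrite [RHS]pair_big /=; apply: eq_bigr => -[i j] _ /=.
by rewrite inE !ffunE.
Qed.

Lemma pushforward_xor_ext (R : realType) m (Ext : bits n -> bits m) X S a :
  X =1 bit_fixing_dist R S a ->
  push (@xor_ext l n m Ext) X =1
  xor_dist Ext (fun i => bit_fixing_dist R (block_set S i) (block a i)).
Proof.
move=> XE y; rewrite /xor_dist (reindex _ (onW_bij _ blocks_bij)) /=.
apply: eq_big => [x|x _].
  congr (_ == _); apply/ffunP => j; rewrite !ffunE.
  by apply: eq_bigr => i _; rewrite ffunE.
by rewrite XE bit_fixing_dist_blocks; apply: eq_bigr => i _; rewrite ffunE.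
Qed.

(** Blocks with fewer than [k] free bits hold at most [l * k] of the [2 * l * k] in total, so the
    others, with at most [n] each, hold at least [l * k]. *)
Lemma many_good_blocks (C k : nat) (S : {set 'I_(l * n)}) :
  (n <= C * k.+1)%N -> #|S| = (2 * l * k)%N ->
  (l <= 2 * C.+1 * #|[set i | (k <= #|block_set S i|)%N]|)%N.
Proof.
move=> nC cS; set g := #|_|.
(* For [k = 0] all blocks count; [C.+1] keeps the factor positive when [C = 0]. *)
case: k => [|k] in nC cS g *.
  have -> : g = l.
    by rewrite /g -[RHS]card_ord -cardsT; apply: eq_card => i; rewrite !inE.
  by nia.
have : (\sum_(i < l) #|block_set S i| <= \sum_(i < l) k.+1 +
    \sum_(i < l | k.+1 <= #|block_set S i|) n)%N.
  rewrite [X in (_ <= _ + X)%N]big_mkcond -big_split leq_sum // => i _ /=.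
  case: (leqP k.+1 #|block_set S i|) => [_|/ltnW]; last by rewrite addn0.
  by apply: leq_trans (max_card _) _; rewrite card_ord leq_addl.
rewrite sum_card_block_set cS !sum_nat_const card_ord.
have -> : #|[pred i | (k < #|block_set S i|)%N]| = g.
  by apply: eq_card => i; rewrite !inE.
move=> H.
(* Uses [k.+2 <= 2 * k.+1] in the bound on [n]. *)
have : (l * k.+1 <= 2 * C.+1 * g * k.+1)%N by nia.
by rewrite leq_pmul2r.
Qed.

End Blocks.

(** * Absorbing the factor 2 into the exponent *)

Section Exponent.
Variable R : realType.

(* The exponent solves [2 * e = e `^ c] at [e = max eps0 4^-1]. *)
Lemma exists_exponent (eps0 : R) : eps0 < 2^-1 ->
  exists2 c : R, 0 < c & forall eps, 0 <= eps <= eps0 -> 2 * eps <= eps `^ c.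
Proof.
(* The maximum keeps [e] positive, so that [ln e] is meaningful, and still below 1/2. *)
move=> h; pose e := Num.max eps0 4^-1.
have e0 : 0 < e by rewrite /e lt_max invr_gt0 ltr0n orbT.
have e2 : e < 2^-1 by rewrite /e gt_max h /= ltf_pV2 ?posrE ?ltr_nat.
have ln2 : 0 < ln 2 :> R by rewrite ln_gt0 // ltr1n.
have lne : ln e < - ln 2 by rewrite -lnV ?posrE // ltr_ln ?posrE ?invr_gt0.
exists (1 + ln 2 / ln e).
  rewrite -ltrBlDl sub0r -(opprK (ln e)) invrN mulrN ltrN2 ltr_pdivrMr; lra.
move=> eps /andP[]; rewrite le_eqVlt => /predU1P[<- _|eps_gt0 le_eps].
  by rewrite mulr0 powR_ge0.
rewrite -ler_ln ?posrE ?mulr_gt0 ?powR_gt0 // lnM ?posrE // ln_powR.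
(* In logarithms the claim reduces to [ln eps / ln e >= 1], true since both are negative and
   [ln eps <= ln e]. *)
have : ln eps <= ln e by rewrite ler_ln ?posrE // /e le_max le_eps.
move=> le_ln; rewrite mulrDl mul1r addrC lerD2l -mulrA ler_peMr ?(ltW ln2) //.
by rewrite mulrC ler_ndivlMr ?mul1r //; lra.
Qed.

End Exponent.

(** * The extractor bound with a linear exponent *)

Unset Implicit Arguments.
Set Strict Implicit.
Set Printing Implicit Defensive.

(* The hidden constants of Theta(l) depend only on a bound C for n / (k + 1)
   and a bound eps0 < 1/2 for eps; every n, k satisfy the bound for C = n. *)
Theorem mainTheorem14 (R : realType) (C : nat) (eps0 : R)
    (heps0 : eps0 < 2^-1) :
  exists2 f : nat -> R, is_Theta_id f &
    forall (n k m : nat) (eps : R) (Ext : bits n -> bits m),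
      (n <= C * k.+1)%N -> 0 <= eps <= eps0 ->
      is_bit_fixing_extractor k eps Ext ->
      forall l : nat,
        is_bit_fixing_extractor (2 * l * k) (eps `^ f l) (@xor_ext l n m Ext).
Proof.
have [c c0 cP] := exists_exponent heps0.
(* Each good block contributes exponent [c], and at least [l / (2 * C.+1)] blocks are good. *)
pose d := c / (2 * C.+1)%:R.
have D0 : 0 < (2 * C.+1)%:R :> R by rewrite ltr0n.
have d0 : 0 < d by rewrite divr_gt0.
exists (fun l => d * l%:R); first by exists d, d; split=> // l; rewrite lexx.
move=> n k m eps Ext nC epsP extE l X [S [a [cS XE]]].
have /andP[eps_ge0 eps_le] := epsP.
pose good := [set i | (k <= #|block_set S i|)%N].
pose e i := if i \in good then 2 * eps else 1.
have -> : stat_dist (push (@xor_ext l n m Ext) X) (@uniform R _) =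
    stat_dist (xor_dist Ext
      (fun i => bit_fixing_dist R (block_set S i) (block a i))) (@uniform R _).
  congr (_ * _); apply: eq_bigr => y _.
  by rewrite (pushforward_xor_ext Ext XE).
apply: le_trans (@xor_dist_uniform _ _ _ _ _ _ e _ _ _ _) _.
- by move=> i t; exact: bit_fixing_dist_ge0.
- by move=> i; exact: sum_bit_fixing_dist.
- by move=> i; rewrite /e; case: ifP => // _; rewrite mulr_ge0.
- move=> i; rewrite /e inE; case: ifP => [ki|]; [right|by left].
  rewrite -ler_pdivrMl ?ltr0n//; apply: (extractor_leq ki extE).
  by exists (block_set S i), (block a i).
rewrite /e -big_mkcond prodr_const /=.
have good_l : d * l%:R <= c * #|good|%:R.
  rewrite /d mulrAC ler_pdivrMr // -mulrA ler_pM2l // mulrC -natrM ler_nat.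
  exact: many_good_blocks nC cS.
apply: (@le_trans _ _ ((eps `^ c) ^+ #|good|)).
  by rewrite lerXn2r ?nnegrE ?mulr_ge0 ?powR_ge0 // cP.
rewrite -powR_mulrn ?powR_ge0 // -powRrM.
(* For [0 < eps <= 1] a larger exponent gives a smaller power. At [eps = 0] the convention that 0 to
   the power 0 is 1 singles out [l = 0], where the bound is 1. *)
have [eps_eq0|eps_neq0] := eqVneq eps 0; last first.
  apply: ger_powR good_l; rewrite lt_def eps_neq0 eps_ge0 /=.
  by rewrite (le_trans eps_le) // (le_trans (ltW heps0)) // invf_le1 ?ler1n.
have [l0|l_gt0] := posnP l.
  by subst l; rewrite mulr0 powRr0 eps_eq0 /powR eqxx lern1 leq_b1.
have dl : 0 < d * l%:R by rewrite mulr_gt0 ?ltr0n.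
by rewrite eps_eq0 !powR0 // gt_eqF // (lt_le_trans dl).
Qed.
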